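(* Let $X$ be an infinite-dimensional Banach space whose dual space $X^\ast$ is separable. Then $X$ admits an equivalent norm which is weakly locally uniformly rotund but not locally uniformly rotund.
   Context: A norm $\|\cdot\|$ on a Banach space is called weakly locally uniformly rotund if for arbitrary points $x_n$ ($n=1,2,\ldots$) and $x$ of its unit sphere, $\lim_{n\to\infty}\|x_n+x\|=2$ implies that $(x_n)_{n=1}^\infty$ converges weakly to $x$. It is called locally uniformly rotund if, for arbitrary such points, $\lim_{n\to\infty}\|x_n+x\|=2$ implies that $(x_n)_{n=1}^\infty$ converges to $x$ in norm. *)

(* Defs.v *)
From HB Require Import structures.
From mathcomp Require Import all_boot all_order all_algebra.
From mathcomp Require Import all_classical all_reals all_analysis.

Set Implicit Arguments.
Unset Strict Implicit.
Unset Printing Implicit Defensive.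

Import Order.TTheory GRing.Theory Num.Theory.
Import numFieldNormedType.Exports.

Local Open Scope classical_set_scope.
Local Open Scope ring_scope.

Section RotundNorms.
Context {R : realType} (X : normedModType R).

Definition finite_dimensional : Prop :=
  exists (n : nat) (e : 'I_n -> X),
    forall x : X, exists a : 'I_n -> R, x = \sum_(i < n) a i *: e i.

Definition topological_dual : set {linear X -> R^o} :=
  [set f | continuous (f : X -> R^o)].

(* [sup] of an unbounded set is 0, so this is the operator norm only for
   bounded functionals, i.e. on [topological_dual]. *)
Definition dual_norm (f : X -> R) : R :=
  sup [set `|f x| | x in [set x : X | `|x| <= 1]].

Definition separable_dual : Prop :=
  exists D : set {linear X -> R^o},
    [/\ countable D,
        D `<=` topological_dual
      & forall f, topological_dual f -> forall e : R, 0 < e ->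
          exists2 g, D g & dual_norm (fun x => f x - g x) < e].

(* Nonnegativity and [N 0 = 0] follow from these axioms. *)
Definition is_norm (N : X -> R) : Prop :=
  [/\ forall x y : X, N (x + y) <= N x + N y,
      forall (a : R) (x : X), N (a *: x) = `|a| * N x
    & forall x : X, N x = 0 -> x = 0].

Definition equivalent_norm (N : X -> R) : Prop :=
  is_norm N /\
  exists c C : R,
    [/\ 0 < c, 0 < C & forall x : X, c * `|x| <= N x <= C * `|x|].

Definition weakly_converges (u : nat -> X) (x : X) : Prop :=
  forall f, topological_dual f -> f (u n) @[n --> \oo] --> f x.

(* Weak convergence is taken with respect to the dual of [X] under its ambient
   norm; this is the dual under [N] whenever [N] is an equivalent norm. *)
Definition weakly_locally_uniformly_rotund (N : X -> R) : Prop :=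
  forall (u : nat -> X) (x : X),
    (forall n, N (u n) = 1) -> N x = 1 ->
    N (u n + x) @[n --> \oo] --> (2 : R) ->
    weakly_converges u x.

Definition locally_uniformly_rotund (N : X -> R) : Prop :=
  forall (u : nat -> X) (x : X),
    (forall n, N (u n) = 1) -> N x = 1 ->
    N (u n + x) @[n --> \oo] --> (2 : R) ->
    N (u n - x) @[n --> \oo] --> (0 : R).

End RotundNorms.

(* Main.v *)
(* Take functionals h_k, dense in the dual after the first one g, with
   |h_k| <= M_k, an equivalent norm p, and put
     N(y)^2 = p(y)^2 + sum_k 4^-k (h_k(y) / M_k)^2.
   The parallelogram identity for the series shows that N(u_n) = N(x) = 1 and
   N(u_n + x) -> 2 force h_k(u_n - x) -> 0 for every k; by density and
   boundedness, N is weakly locally uniformly rotund whatever p is.  On the other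
   hand, as X is infinite-dimensional there are unit vectors z_n killed by
   h_0, ..., h_n.  If p = max(2 |g|, |.|) and |x| = g(x) = 1, then
   p(x + z_n) = p(x) while the series at x + z_n tends to the series at x, so
   N(x + z_n) -> N(x) and N(2 x + z_n) -> 2 N(x), although z_n does not tend
   to 0. *)
Require Import Defs.
From HB Require Import structures.
From mathcomp Require Import all_boot all_order all_algebra.
From mathcomp Require Import all_classical all_reals all_analysis.
From mathcomp Require Import ring lra.

Set Implicit Arguments.
Unset Strict Implicit.
Unset Printing Implicit Defensive.

Import Order.TTheory GRing.Theory Num.Theory.
Import numFieldNormedType.Exports.

Local Open Scope classical_set_scope.
Local Open Scope ring_scope.

(** * The Hahn-Banach theorem: norming functionals *)

Section HahnBanach.
Context {R : realType} {X : normedModType R}.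
Implicit Types (G : set (X * R)) (x v : X).

(** A partial functional of norm at most 1 is coded by its graph, so that Zorn's lemma can be run on
    inclusion. Single-valuedness follows from domination, applied to the difference of two pairs
    over the same point. *)
Definition dominated_graph G : Prop :=
  (forall (t : R) z w, G z -> G w -> G (t *: z.1 + w.1, t * z.2 + w.2)) /\
  (forall z, G z -> z.2 <= `|z.1|).

(** The value [a] at [v] must lie above every [z.2 - |z.1 - v|] and below every [|w.1 + v| - w.2];
    the supremum of the former works. Nonzero [t] reduce to [1] and [-1] by scaling. *)
Lemma dominated_graph_extension G v : dominated_graph G -> G (0, 0) ->
  exists a : R, forall z t, G z -> z.2 + t * a <= `|z.1 + t *: v|.
Proof.
move=> [Glin Gle] G0.
have GZ t z : G z -> G (t *: z.1, t * z.2).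
  by move=> Gz; have := Glin t _ _ Gz G0; rewrite !addr0.
pose E := [set z.2 - `|z.1 - v| | z in G].
have ub z w : G z -> G w -> z.2 - `|z.1 - v| <= `|w.1 + v| - w.2.
  move=> Gz Gw; rewrite lerBrDr addrAC lerBlDr.
  have := Gle _ (Glin 1 _ _ Gz Gw); rewrite /= scale1r mul1r => /le_trans; apply.
  rewrite addrC (le_trans _ (ler_normD _ _))// addrACA.
  by rewrite subrr addr0.
have hE z : G z -> z.2 - `|z.1 - v| <= sup E <= `|z.1 + v| - z.2.
  move=> Gz; apply/andP; split.
    apply: ub_le_sup; last by exists z.
    by exists (`|z.1 + v| - z.2) => _ [w Gw <-]; exact: ub.
  apply: ge_sup; first by exists (z.2 - `|z.1 - v|), z.
  by move=> _ [w Gw <-]; exact: ub.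
exists (sup E) => z t Gz.
have [t0|t0|->] := ltgtP t 0; last by rewrite mul0r scale0r !addr0; exact: Gle.
  have s0 : 0 < - t by rewrite oppr_gt0.
  have /hE/andP[/= + _] := GZ (- t)^-1 _ Gz.
  rewrite lerBlDr -lerBlDl -(ler_pM2l s0) mulrBr mulrA mulfV ?gt_eqF// mul1r.
  rewrite mulNr opprK -[X in _ <= X * _](gtr0_norm s0) -normrZ scalerBr scalerA.
  by rewrite mulfV ?gt_eqF// scale1r scaleNr opprK.
have /hE/andP[_ /=] := GZ t^-1 _ Gz.
rewrite lerBrDr addrC -(ler_pM2l t0) mulrDr mulrA mulfV ?gt_eqF// mul1r.
rewrite -[X in _ <= X * _](gtr0_norm t0) -normrZ scalerDr scalerA.
by rewrite mulfV ?gt_eqF// scale1r.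
Qed.

Lemma norming_functional x :
  exists f : {linear X -> R^o}, (forall y, `|f y| <= `|y|) /\ f x = `|x|.
Proof.
pose P := [set G | dominated_graph G /\ forall z, G z -> G (x, `|x|)].
have [|G [[[Glin Gle] Gx] Gmax]] := @Zorn_bigcup _ P.
  move=> F FP Ftot; split; last first.
    by move=> z [H FH Hz]; exists H => //; exact: (FP _ FH).2 Hz.
  split=> [t z w [H FH Hz] [K FK Kw]|z [H FH Hz]]; last first.
    by have [[_ +] _] := FP _ FH; apply.
  have [HK|KH] := Ftot _ _ FH FK.
    by exists K => //; have [[+ _] _] := FP _ FK; apply => //; exact: HK.
  by exists H => //; have [[+ _] _] := FP _ FH; apply => //; exact: KH.
have {}Gx : G (x, `|x|).
  apply: contrapT => nGx.
  (* A graph in [P] missing [(x, |x|)] is empty, so the line through that pair is strictly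
     larger. *)
  apply: (Gmax [set (t *: x, t * `|x|) | t in [set: R]]).
    split=> [z /Gx//|/(_ (x, `|x|))sub]; apply: nGx; apply: sub.
    by exists 1; rewrite // scale1r mul1r.
  split; first split=> [t _ _ [r _ <-] [s _ <-]|_ [r _ <-]] /=.
  - by exists (t * r + s); rewrite //= scalerDl mulrDl scalerA mulrA.
  - by rewrite normrZ ler_wpM2r// ler_norm.
  - by move=> _ _; exists 1; rewrite // scale1r mul1r.
have G0 : G (0, 0).
  have := Glin (-1) _ _ Gx Gx.
  by rewrite /= scaleN1r mulN1r !addNr.
have Gtot v : exists r, G (v, r).
  have [a aP] := dominated_graph_extension v (conj Glin Gle) G0.
  pose H := [set (z.1 + t *: v, z.2 + t * a) | z in G & t in [set: R]].
  have GH : G `<=` H.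
    move=> [y r] Gz; exists (y, r) => //; exists 0 => //=.
    by rewrite scale0r mul0r !addr0.
  exists a; apply: contrapT => nGv; apply: (Gmax H).
    split=> // /(_ (v, a)) HG; apply/nGv/HG; exists (0, 0) => //.
    by exists 1; rewrite //= scale1r mul1r !add0r.
  split; last by move=> _ _; exact: GH.
  split=> [t _ _ [z Gz [r _ <-]] [w Gw [s _ <-]]|_ [z Gz [r _ <-]]]; last exact: aP.
  exists (t *: z.1 + w.1, t * z.2 + w.2); first exact: Glin.
  exists (t * r + s) => //=; congr (_, _); last by ring.
  by rewrite scalerDr scalerDl scalerA addrACA.
have [f fP] := choice Gtot.
have Guniq v r s : G (v, r) -> G (v, s) -> r = s.
  move=> Gr Gs; apply/le_anti/andP; split; rewrite -subr_ge0.
    by have := Gle _ (Glin (-1) _ _ Gs Gr); rewrite /= scaleN1r addNr normr0; lra.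
  by have := Gle _ (Glin (-1) _ _ Gr Gs); rewrite /= scaleN1r addNr normr0; lra.
have flin : linear (f : X -> R^o).
  by move=> t u v; apply: Guniq (fP _) _; exact: (Glin t (u, f u) (v, f v)).
pose fL := HB.pack_for {linear X -> R^o} f (GRing.isLinear.Build _ _ _ _ f flin).
exists fL; split=> [y|]; last exact: Guniq (fP x) Gx.
have fle v : fL v <= `|v| := Gle _ (fP v).
by rewrite ler_norml fle andbT lerNl -linearN -normrN.
Qed.

End HahnBanach.

(** * Bounded functionals, dense sequences and joint kernels *)

Section Dual.
Context {R : realType} {X : normedModType R}.

Lemma topological_dualP (f : {linear X -> R^o}) :
  topological_dual f <-> exists2 M : R, 0 < M & forall y, `|f y| <= M * `|y|.
Proof.
split=> [fcont|[M M0 fM]]; last first.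
  apply/linear_bounded_continuous/linear_boundedP.
  exists M; split=> [|r Mr y]; first exact: gtr0_real.
  by apply: (le_trans (fM y)); rewrite ler_wpM2r// ltW.
have /linear_boundedP/pinfty_ex_gt0[M M0 fM] :=
  (linear_bounded_continuous f).2 fcont.
by exists M.
Qed.

(** Continuity bounds the set under [sup], which is therefore a true supremum and not the default
    0. *)
Lemma le_dual_norm (f : {linear X -> R^o}) y :
  topological_dual f -> `|f y| <= dual_norm f * `|y|.
Proof.
move=> /topological_dualP[M M0 fM].
have [->|y0] := eqVneq y 0; first by rewrite linear0 !normr0 mulr0.
have ny0 : 0 < `|y| by rewrite normr_gt0.
rewrite -ler_pdivrMr//; apply: ub_le_sup.
  exists M => _ [x /= x1 <-]; apply: (le_trans (fM x)).
  by rewrite -[leRHS]mulr1 ler_wpM2l// ltW.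
exists (`|y|^-1 *: y) => /=.
  by rewrite normrZ gtr0_norm ?invr_gt0// mulVf ?gt_eqF.
by rewrite linearZ/= normrM gtr0_norm ?invr_gt0// mulrC.
Qed.

Lemma separable_dual_sequence : separable_dual X ->
  exists h : nat -> {linear X -> R^o}, (forall k, topological_dual (h k)) /\
  forall f, topological_dual f -> forall e : R, 0 < e ->
    exists k, forall y, `|f y - h k y| <= e * `|y|.
Proof.
move=> [D [Dcount Ddual Ddense]].
have /pfcard_geP[D0|[h]] := Dcount.
  (* An empty [D] contradicts density at any continuous functional. *)
  have [f [fle _]] := @norming_functional R X 0.
  have fdual : topological_dual f.
    by apply/topological_dualP; exists 1 => // y; rewrite mul1r.
  by have [g] := Ddense _ fdual _ ltr01; rewrite D0.
have hdual k : topological_dual (h k) by apply: Ddual; exact: funS.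
exists h; split=> // f fdual e e0.
have [g Dg ge] := Ddense f fdual e e0.
have [k _ hk] := @surj _ _ _ _ h g Dg.
exists k => y; rewrite hk.
have dual_sub : topological_dual (f \- g)%R.
  by move=> x; apply: continuousB; [exact: fdual|exact: Ddual].
apply: (le_trans (le_dual_norm y dual_sub)).
by rewrite ler_wpM2r// ltW.
Qed.

(** Each functional cuts the dimension by at most one: if [h n] does not vanish on the joint kernel
    of its predecessors, one vector [v] of that kernel with [h n v != 0] completes the spanning
    family. *)
Lemma spanned_joint_kernel (h : nat -> {linear X -> R^o}) n m (e : 'I_m -> X) :
  (forall x, (forall k, (k < n)%N -> h k x = 0) ->
    exists a : 'I_m -> R, x = \sum_(i < m) a i *: e i) ->
  finite_dimensional X.
Proof.
elim: n m e => [|n IHn] m e espan.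
  by exists m, e => x; exact: espan.
have [[v [vker vn0]]|nov] :=
    pselect (exists v, (forall k, (k < n)%N -> h k v = 0) /\ h n v != 0); last first.
  apply: (IHn m e) => x xker; apply: espan => k; rewrite ltnS leq_eqVlt.
  move=> /orP[/eqP->|/xker//]; apply/eqP/negPn/negP => xn0.
  by apply: nov; exists x.
pose e' i := if unlift ord0 i is Some j then e j else v.
apply: (IHn m.+1 e') => x xker.
have [k|a xE] := espan (x - (h n x / h n v) *: v).
  rewrite linearB linearZ/= ltnS leq_eqVlt => /orP[/eqP->|kn].
    by rewrite -[_ *: _]/(_ * _) divfK// subrr.
  by rewrite (xker k kn) (vker k kn) scaler0 subr0.
exists (fun i => if unlift ord0 i is Some j then a j else h n x / h n v).
rewrite big_ord_recl /e' unlift_none.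
under eq_bigr do rewrite liftK.
by rewrite -xE addrC subrK.
Qed.

Lemma unit_vector_joint_kernel (h : nat -> {linear X -> R^o}) n :
  ~ finite_dimensional X ->
  exists z : X, `|z| = 1 /\ forall k, (k < n)%N -> h k z = 0.
Proof.
move=> infdim.
have [z [zker z0]] : exists z, (forall k, (k < n)%N -> h k z = 0) /\ z != 0.
  apply: contrapT => noz; apply: infdim.
  (* A trivial joint kernel is spanned by the empty family. *)
  apply: (@spanned_joint_kernel h n 0 (fun=> 0)) => x xker.
  exists (fun=> 0); rewrite big_ord0; apply/eqP/negPn/negP => x0.
  by apply: noz; exists x.
exists (`|z|^-1 *: z); split=> [|k kn]; last by rewrite linearZ/= zker// scaler0.
by rewrite normrZ gtr0_norm ?invr_gt0 ?normr_gt0// mulVf ?normr_eq0.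
Qed.

End Dual.

(** * Limits of series and convexity of the square *)

Section SeriesComb.
Context {R : realType}.
Implicit Types (u v w : R ^nat) (a b : R).

Lemma cvg_series_comb u v a b : cvgn (series u) -> cvgn (series v) ->
  series (fun k => a * u k + b * v k) @ \oo -->
  a * limn (series u) + b * limn (series v).
Proof.
move=> cu cv.
rewrite (_ : series _ = (fun n => a * series u n + b * series v n)); last first.
  by apply/funext => n; rewrite /series/= big_split/= !mulr_sumr.
by apply: cvgD; apply: cvgMl_tmp.
Qed.

Lemma le_lim_series_comb u v w a b :
  cvgn (series u) -> cvgn (series v) -> cvgn (series w) ->
  (forall k, w k <= a * u k + b * v k) ->
  limn (series w) <= a * limn (series u) + b * limn (series v).
Proof.
move=> cu cv cw wle; have cuv := cvg_series_comb (a := a) (b := b) cu cv.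
rewrite -(cvg_lim _ cuv)//; apply: lim_series_le => //.
exact: (cvgP _ cuv).
Qed.

(** The two sides differ by a square over [t * (1 - t)]. As [t] and [s] may be the same for all
    summands, the bound can be summed along a series, which gives the triangle inequality for
    [N]. *)
Lemma sqrD_le_convex (a b t s : R) : 0 < t -> 0 < s -> t + s = 1 ->
  (a + b) ^+ 2 <= t^-1 * a ^+ 2 + s^-1 * b ^+ 2.
Proof.
move=> t0 s0 ts; have sE : s = 1 - t by lra.
have tn0 : t != 0 by rewrite gt_eqF.
have sn0 : 1 - t != 0 by rewrite -sE gt_eqF.
rewrite -subr_ge0 sE.
have -> : t^-1 * a ^+ 2 + (1 - t)^-1 * b ^+ 2 - (a + b) ^+ 2 =
          ((1 - t) * a - t * b) ^+ 2 / (t * (1 - t)).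
  by field; apply/andP.
by rewrite divr_ge0 ?sqr_ge0// mulr_ge0 -?sE// ltW.
Qed.

End SeriesComb.

(** * The norm built from [p] and the weighted square series *)

Section Renorming.
Context {R : realType} {X : normedModType R}.
Variables (h : nat -> {linear X -> R^o}) (M : nat -> R).
Hypothesis M_gt0 : forall k, 0 < M k.
Hypothesis hM : forall k y, `|h k y| <= M k * `|y|.
Variables (p : X -> R) (C : R).
Hypothesis pD : forall x y, p (x + y) <= p x + p y.
Hypothesis pZ : forall a x, p (a *: x) = `|a| * p x.
Hypothesis p_ge : forall x, `|x| <= p x.
Hypothesis p_le : forall x, p x <= C * `|x|.

(** Normalised so that [|c k y| <= 2^-k |y|]; squaring produces the weight [4^-k]. *)
Let c k y : R := h k y / M k / 2 ^+ k.
Let sqc y k : R := c k y ^+ 2.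

Let cD k x y : c k (x + y) = c k x + c k y.
Proof. by rewrite /c linearD/= !mulrDl. Qed.

Let cZ k a y : c k (a *: y) = a * c k y.
Proof. by rewrite /c linearZ/= -!mulrA. Qed.

Let sqc_ge0 y k : 0 <= sqc y k. Proof. exact: sqr_ge0. Qed.

Let sqc_le y k : sqc y k <= (2^-1 ^+ k * `|y|) ^+ 2.
Proof.
have hy : 0 <= 2^-1 ^+ k * `|y| by rewrite mulr_ge0// exprn_ge0// invr_ge0.
rewrite -[leLHS]real_normK ?num_real// ler_sqr ?nnegrE//.
have k0 : 0 < (2 : R) ^+ k by rewrite exprn_gt0.
rewrite /c !normrM !normfV (gtr0_norm (M_gt0 k)) (gtr0_norm k0).
by rewrite exprVn mulrC ler_wpM2l ?invr_ge0 ?(ltW k0)// ler_pdivrMr// mulrC.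
Qed.

Let half_lt1 : `|2^-1 : R| < 1.
Proof. by rewrite ger0_norm ?invr_ge0// invf_lt1// ltr1n. Qed.

Let half_series_cvg a : cvgn (series (geometric a (2^-1 : R))).
Proof. exact: is_cvg_geometric_series. Qed.

Let half_series_lim : limn (series (geometric 1 (2^-1 : R))) = 2.
Proof.
rewrite (cvg_lim _ (cvg_geometric_series half_lt1))// mul1r.
by rewrite [X in X - _](splitr 1) div1r addrK invrK.
Qed.

Let exp_half_ge0 k : 0 <= (2^-1 : R) ^+ k.
Proof. by rewrite exprn_ge0// invr_ge0. Qed.

Let exp_half_le1 k : (2^-1 : R) ^+ k <= 1.
Proof. by rewrite exprn_ile1// ?invr_ge0// invf_le1// ler1n. Qed.

Let sqc_le_geometric y k : sqc y k <= geometric (`|y| ^+ 2) 2^-1 k.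
Proof.
apply: (le_trans (sqc_le y k)); rewrite exprMn mulrC ler_wpM2l ?sqr_ge0//.
by rewrite expr2 ler_piMl.
Qed.

Let sqc_cvg y : cvgn (series (sqc y)).
Proof.
apply: (@series_le_cvg _ _ _ _ _ (sqc_le_geometric y)) => // k.
by rewrite /geometric/= mulr_ge0// sqr_ge0.
Qed.

Let S y : R := limn (series (sqc y)).

Let sqc_le_S y k : sqc y k <= S y.
Proof.
have mono : nondecreasing_seq (series (sqc y)).
  apply/nondecreasing_seqP => n.
  by rewrite /series/= big_nat_recr//= lerDl.
have := nondecreasing_cvgn_le mono (@sqc_cvg y) k.+1; apply: le_trans.
by rewrite /series/= big_nat_recr//= lerDr sumr_ge0.
Qed.

Let S_ge0 y : 0 <= S y. Proof. exact: le_trans (sqc_le_S y 0). Qed.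

Let S_le_comb x y z a b :
  (forall k, sqc z k <= a * sqc x k + b * sqc y k) -> S z <= a * S x + b * S y.
Proof. exact: le_lim_series_comb. Qed.

(** Each [c k] is linear, so the identity holds term by term and passes to the limit. *)
Let S_parallelogram x y : S (x + y) + S (x - y) = 2 * S x + 2 * S y.
Proof.
have c1 := cvg_series_comb (a := 1) (b := 1) (@sqc_cvg (x + y)) (@sqc_cvg (x - y)).
have c2 := cvg_series_comb (a := 2) (b := 2) (@sqc_cvg x) (@sqc_cvg y).
rewrite -[S (x + y)]mul1r -[S (x - y)]mul1r -(cvg_lim _ c1)// -(cvg_lim _ c2)//.
congr (limn (series _)); apply/funext => k.
by rewrite /sqc -[- y]scaleN1r !cD cZ; ring.
Qed.

Let SZ a y : S (a *: y) = a ^+ 2 * S y.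
Proof.
have c1 := cvg_series_comb (a := a ^+ 2) (b := 0) (@sqc_cvg y) (@sqc_cvg y).
rewrite -[RHS]addr0 -(mul0r (S y)) -(cvg_lim _ c1)//.
by congr (limn (series _)); apply/funext => k; rewrite /sqc cZ mul0r addr0 exprMn.
Qed.

(* From index [n] on, the weight [4^-k] is at most [2^-n * 2^-k], and the sum of
   the [2^-k] is [2]. *)
Let S_le_agree n y y' : (forall k, (k < n)%N -> h k y = h k y') ->
  S y' <= S y + 2 * 2^-1 ^+ n * `|y'| ^+ 2.
Proof.
move=> yy'.
have -> : S y + 2 * 2^-1 ^+ n * `|y'| ^+ 2 =
    1 * S y + 2^-1 ^+ n * `|y'| ^+ 2 * limn (series (geometric 1 (2^-1 : R))).
  by rewrite half_series_lim mul1r -mulrA [2 * _]mulrC.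
apply: le_lim_series_comb => // k; rewrite /geometric/= !mul1r.
have [kn|nk] := ltnP k n.
  by rewrite /sqc /c yy'// lerDl !mulr_ge0// sqr_ge0.
apply: (le_trans (sqc_le y' k)); rewrite -[leLHS]add0r lerD//.
rewrite exprMn expr2 mulrAC ler_wpM2r// ler_wpM2r ?sqr_ge0//.
by rewrite ler_wiXn2l// ?invr_ge0// invf_le1// ler1n.
Qed.

(** The tail estimate at [n = 0], compared with the zero vector: agreement is vacuous and
    [S 0 = 0]. *)
Let S_le y : S y <= 2 * `|y| ^+ 2.
Proof.
have := @S_le_agree 0 0 y (fun k => ltac:(by [])).
by rewrite expr0 mulr1 -(scale0r (0 : X)) SZ expr0n mul0r add0r.
Qed.

Let F y : R := p y ^+ 2 + S y.

Definition quadratic_renorm y : R :=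
  Num.sqrt (p y ^+ 2 + limn (series (fun k => (h k y / M k / 2 ^+ k) ^+ 2))).

Let N := quadratic_renorm.

Let p_ge0 y : 0 <= p y. Proof. exact: le_trans (normr_ge0 y) (p_ge y). Qed.

Let F_ge0 y : 0 <= F y. Proof. by rewrite addr_ge0 ?sqr_ge0 ?S_ge0. Qed.

Let N_ge0 y : 0 <= N y. Proof. exact: sqrtr_ge0. Qed.

Let N2 y : N y ^+ 2 = F y. Proof. exact: sqr_sqrtr (F_ge0 y). Qed.

Let NE y : N y = Num.sqrt (F y). Proof. by []. Qed.

Let NZ a y : N (a *: y) = `|a| * N y.
Proof.
rewrite !NE /F pZ SZ exprMn real_normK ?num_real// -mulrDr sqrtrM ?sqr_ge0//.
by rewrite sqrtr_sqr.
Qed.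

Let p_le_N y : p y <= N y.
Proof. by rewrite -ler_sqr ?nnegrE// N2 lerDl. Qed.

Let norm_le_N y : `|y| <= N y. Proof. exact: le_trans (p_le_N y). Qed.

Let N_eq0 y : N y = 0 -> y = 0.
Proof.
by move=> Ny; apply/eqP; rewrite -normr_le0 -Ny.
Qed.

Let ND x y : N (x + y) <= N x + N y.
Proof.
have [/N_eq0->|Nx] := eqVneq (N x) 0; first by rewrite add0r lerDr.
have [/N_eq0->|Ny] := eqVneq (N y) 0; first by rewrite addr0 lerDl.
have x0 : 0 < N x by rewrite lt_def Nx N_ge0.
have y0 : 0 < N y by rewrite lt_def Ny N_ge0.
have xy0 : 0 < N x + N y by rewrite addr_gt0.
(* Weights proportional to the norms make the convexity bound for [N x + N y] an equality. *)
pose t := N x / (N x + N y); pose s := N y / (N x + N y).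
have t0 : 0 < t by rewrite divr_gt0.
have s0 : 0 < s by rewrite divr_gt0.
have ts : t + s = 1 by rewrite -mulrDl mulfV ?gt_eqF.
rewrite -ler_sqr ?nnegrE ?N_ge0 ?(ltW xy0)// N2.
have -> : (N x + N y) ^+ 2 = t^-1 * F x + s^-1 * F y.
  by rewrite -!N2 /t /s; field; rewrite Nx Ny gt_eqF.
have Sle : S (x + y) <= t^-1 * S x + s^-1 * S y.
  by apply: S_le_comb => k; rewrite /sqc cD sqrD_le_convex.
have ple : p (x + y) ^+ 2 <= t^-1 * p x ^+ 2 + s^-1 * p y ^+ 2.
  apply: (le_trans _ (sqrD_le_convex (p x) (p y) t0 s0 ts)).
  by rewrite ler_sqr ?nnegrE ?addr_ge0.
by rewrite /F; lra.
Qed.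

Lemma quadratic_renorm_equivalent : equivalent_norm quadratic_renorm.
Proof.
split; first by split=> [x y|a x|x]; [exact: ND|exact: NZ|exact: N_eq0].
(* [N x ^+ 2 <= (C ^+ 2 + 2) |x|^2], and [C ^+ 2 + 2 <= (|C| + 2) ^+ 2]. *)
exists 1, (`|C| + 2); split=> // x.
rewrite mul1r norm_le_N/= -ler_sqr ?nnegrE ?mulr_ge0 ?addr_ge0// N2.
have pC : p x <= `|C| * `|x|.
  by rewrite (le_trans (p_le x))// ler_wpM2r// ler_norm.
have : p x ^+ 2 <= (`|C| * `|x|) ^+ 2 by rewrite ler_sqr ?nnegrE ?mulr_ge0.
have := S_le x; rewrite /F => Sx px.
have : 0 <= `|C| * `|x| ^+ 2 by rewrite mulr_ge0.
have : 0 <= `|x| ^+ 2 by [].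
nra.
Qed.

(** By the parallelogram identity for [S] and [p (u + x) ^+ 2 <= 2 p u ^+ 2 + 2 p x ^+ 2], unit
    vectors satisfy [S (u - x) <= 4 - N (u + x) ^+ 2]; each term of the series inherits this
    bound. *)
Lemma quadratic_renorm_wlur :
  (forall f : {linear X -> R^o}, topological_dual f -> forall e : R, 0 < e ->
    exists k, forall y, `|f y - h k y| <= e * `|y|) ->
  weakly_locally_uniformly_rotund quadratic_renorm.
Proof.
move=> dense u x Nu Nx /cvgrPdist_lt Nux f fdual.
apply/cvgrPdist_lt => e e0.
(* Since [|u n - x| <= 2], replacing [f] by [h k] costs at most [e / 2]. *)
have [|k fk] := dense f fdual (e / 4); first by rewrite divr_gt0.
pose K := M k * 2 ^+ k.
have K0 : 0 < K by rewrite mulr_gt0// exprn_gt0.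
pose d := e / 2 / K.
have d0 : 0 < d by rewrite !divr_gt0.
near=> n.
(* As [N (u n + x) <= 2], [4 - N (u n + x) ^+ 2] is at most four times [2 - N (u n + x)]. *)
have Nn : `|2 - N (u n + x)| < d ^+ 2 / 4.
  by near: n; apply: Nux; rewrite divr_gt0// exprn_gt0.
set w := u n - x.
have wle : `|w| <= 2.
  rewrite (le_trans (ler_normB _ _))//.
  by have := norm_le_N (u n); have := norm_le_N x; rewrite /N Nu Nx; lra.
have N_le2 : N (u n + x) <= 2.
  by apply: (le_trans (ND _ _)); rewrite /N Nu Nx; lra.
have Fle : 4 - F (u n + x) < d ^+ 2.
  move: Nn; rewrite ger0_norm ?subr_ge0// -N2.
  by have := N_ge0 (u n + x); nra.
have ckw : c k w ^+ 2 < d ^+ 2.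
  apply: le_lt_trans Fle; apply: (le_trans (sqc_le_S w k)).
  have := S_parallelogram (u n) x; rewrite -/w.
  have : p (u n + x) ^+ 2 <= 2 * p (u n) ^+ 2 + 2 * p x ^+ 2.
    apply: (@le_trans _ _ ((p (u n) + p x) ^+ 2)).
      by rewrite ler_sqr ?nnegrE ?addr_ge0.
    by have := sqr_ge0 (p (u n) - p x); nra.
  have := N2 (u n); have := N2 x; rewrite /N Nu Nx /F; lra.
have hkw : `|h k w| < e / 2.
  have := ckw; rewrite -[X in X < _]real_normK ?num_real//.
  rewrite ltr_sqr ?nnegrE ?(ltW d0)//.
  rewrite /c -mulrA -invfM normrM normfV (gtr0_norm K0) /d.
  by rewrite ltr_pM2r// invr_gt0.
rewrite distrC -linearB -/w -[f w](subrK (h k w)).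
rewrite (le_lt_trans (ler_normD _ _))// (splitr e) ler_ltD//.
apply: (le_trans (fk w)); nra.
Unshelve. all: by end_near. Qed.

(** The witnesses are [x + z n] and [x], each normalised. Flatness of [p] is asked for all
    [|b| <= |a|] because their sum has unequal coefficients on [x] and [z n]. *)
Lemma quadratic_renorm_not_lur x (z : nat -> X) : x != 0 ->
  (forall n, `|z n| = 1) ->
  (forall n k, (k < n)%N -> h k (z n) = 0) ->
  (forall n a b, `|b| <= `|a| -> p (a *: x + b *: z n) = `|a| * p x) ->
  ~ locally_uniformly_rotund quadratic_renorm.
Proof.
move=> xn0 z1 hz pz lur.
pose e n : R := 2 * 2^-1 ^+ n.
have e_cvg : e @ \oo --> (0 : R) by apply: cvg_geometric.
have e_ge0 n : 0 <= e n by rewrite mulr_ge0.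
have Nx0 : 0 < N x by rewrite (lt_le_trans _ (norm_le_N x))// normr_gt0.
(* Both vectors have the same [p], and their [S] differ by at most [e n * (|a| N x) ^+ 2]. For
   [e n <= 1], [(1 - e n) ^+ 2 <= 1 - e n] and [1 + e n <= (1 + e n) ^+ 2] let the bounds pass from
   [N ^+ 2] to [N]. *)
have bounds n a b : `|b| <= `|a| -> e n <= 1 ->
    `|a| * (1 - e n) * N x <= N (a *: x + b *: z n) <= `|a| * (1 + e n) * N x.
  move=> ba en1; set y := a *: x + b *: z n.
  have agree k : (k < n)%N -> h k (a *: x) = h k y.
    by move=> kn; rewrite linearD [h k (b *: _)]linearZ/= hz// scaler0 addr0.
  have pa : p y = `|a| * p x by exact: pz.
  have Fa : F (a *: x) = (`|a| * N x) ^+ 2 by rewrite -N2 NZ.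
  have pxa : p (a *: x) = p y by rewrite pZ pa.
  have ay : `|y| ^+ 2 <= (`|a| * N x) ^+ 2.
    rewrite ler_sqr ?nnegrE ?mulr_ge0//; apply: (le_trans (p_ge y)).
    by rewrite pa ler_wpM2l.
  have ax : `|a *: x| ^+ 2 <= (`|a| * N x) ^+ 2.
    by rewrite ler_sqr ?nnegrE ?mulr_ge0// normrZ ler_wpM2l.
  have up := S_le_agree agree.
  have lo := S_le_agree (fun k kn => esym (agree k kn)).
  rewrite -/(e n) in up lo.
  set q := `|a| * N x in Fa ay ax.
  have q0 : 0 <= q by rewrite mulr_ge0.
  have up' : N y ^+ 2 <= q ^+ 2 + e n * q ^+ 2.
    move: Fa; rewrite N2 /F pxa => Fa; have := ler_wpM2l (e_ge0 n) ay; lra.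
  have lo' : q ^+ 2 <= N y ^+ 2 + e n * q ^+ 2.
    move: Fa; rewrite N2 /F pxa => Fa; have := ler_wpM2l (e_ge0 n) ax; lra.
  have e0 := e_ge0 n.
  have q20 := sqr_ge0 q.
  have qe1 : 0 <= q * (1 - e n) by rewrite mulr_ge0// subr_ge0.
  have qe2 : 0 <= q * (1 + e n) by rewrite mulr_ge0// addr_ge0.
  have e1q : 0 <= e n * (1 - e n) * q ^+ 2 by rewrite !mulr_ge0// subr_ge0.
  have eq2 : 0 <= e n ^+ 2 * q ^+ 2 by rewrite mulr_ge0// sqr_ge0.
  have eq1 : 0 <= e n * q ^+ 2 by rewrite mulr_ge0.
  rewrite mulrAC [X in _ && (_ <= X)]mulrAC -/q.
  by apply/andP; split; rewrite -ler_sqr ?nnegrE//; nra.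
pose al n := N (x + z n).
have al_bounds n : e n <= 1 -> (1 - e n) * N x <= al n <= (1 + e n) * N x.
  by move=> en1; have := bounds n 1 1 (lexx _) en1; rewrite normr1 !scale1r !mul1r.
have al_gt0 n : 0 < al n.
  rewrite lt_def N_ge0 andbT; apply/eqP => /N_eq0 xz.
  have := pz n 1 1 (lexx _); rewrite !scale1r xz normr1 mul1r.
  rewrite -(scale0r (0 : X)) pZ normr0 mul0r => px0.
  by move: (p_ge x); rewrite -px0 normr_le0 (negPf xn0).
pose u n := (al n)^-1 *: (x + z n).
pose x' := (N x)^-1 *: x.
have Nu n : N (u n) = 1.
  by rewrite NZ gtr0_norm ?invr_gt0// mulVf ?gt_eqF.
have Nx' : N x' = 1.
  by rewrite NZ gtr0_norm ?invr_gt0// mulVf ?gt_eqF.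
have e_small d : 0 < d -> \forall n \near \oo, e n < d.
  move=> d0; move/cvgrPdist_lt : e_cvg => /(_ d d0); apply: filterS => n.
  by rewrite sub0r normrN ger0_norm.
have Nux : N (u n + x') @[n --> \oo] --> (2 : R).
  apply/cvgrPdist_lt => d d0; near=> n.
  have en1 : e n < 1 by near: n; exact: e_small.
  (* The lower bound will be [(1 - e n) * (2 - e n) >= 2 - 3 * e n]. *)
  have en3 : e n < d / 3 by near: n; apply: e_small; rewrite divr_gt0.
  have uE : u n + x' = ((al n)^-1 + (N x)^-1) *: x + (al n)^-1 *: z n.
    by rewrite /u /x' scalerDr scalerDl addrAC.
  have al0 : 0 < (al n)^-1 by rewrite invr_gt0.
  have be0 : 0 < (N x)^-1 by rewrite invr_gt0.
  have ab : `|(al n)^-1| <= `|(al n)^-1 + (N x)^-1|.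
    by rewrite !gtr0_norm ?addr_gt0// lerDl ltW.
  have /andP[lo _] := bounds n _ _ ab (ltW en1).
  have N_le2 : N (u n + x') <= 2 by rewrite (le_trans (ND _ _))// Nu Nx'.
  rewrite ger0_norm ?subr_ge0//; move: lo; rewrite -uE gtr0_norm ?addr_gt0// => lo.
  have /andP[_ alle] := al_bounds n (ltW en1).
  have r1 : 1 - e n <= (al n)^-1 * N x.
    rewrite mulrC ler_pdivlMr//.
    have := ler_wpM2l (_ : 0 <= 1 - e n) alle; rewrite subr_ge0 => /(_ (ltW en1)).
    have : 0 <= e n ^+ 2 * N x by rewrite mulr_ge0// sqr_ge0.
    nra.
  have {lo} : ((al n)^-1 * N x + 1) * (1 - e n) <= N (u n + x').
    apply: le_trans lo; have Nxn0 : N x != 0 by rewrite gt_eqF.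
    by rewrite [leRHS]mulrAC [in leRHS]mulrDl mulVf.
  have := ler_wpM2r (_ : 0 <= 1 - e n) r1; rewrite subr_ge0 => /(_ (ltW en1)).
  have := sqr_ge0 (e n); nra.
(* With [al n <= 2 * N x], this threshold bounds [N (z n)] by [1/2 + 1/4], against [|z n| = 1]. *)
have /cvgrPdist_lt/(_ (4 * N x)^-1) := lur _ _ Nu Nx' Nux.
rewrite invr_gt0 mulr_gt0// => /(_ isT) Nsmall.
near \oo => n.
have : `|0 - N (u n - x')| < (4 * N x)^-1 by near: n.
rewrite sub0r normrN ger0_norm// => dn.
have en1 : e n < 1 by near: n; exact: e_small.
have enx : e n < (4 * N x)^-1 by near: n; apply: e_small; rewrite invr_gt0 mulr_gt0.
have /andP[lo up] := al_bounds n (ltW en1).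
have zE : z n = al n *: (u n - x') + (al n / N x - 1) *: x.
  rewrite scalerBr /u /x' !scalerA mulfV ?gt_eqF// scale1r scalerBl scale1r.
  by rewrite addrA subrK [x + z n]addrC addrK.
have Nz : 1 <= al n * N (u n - x') + `|al n - N x|.
  rewrite -(z1 n) (le_trans (norm_le_N _))// {1}zE (le_trans (ND _ _))// !NZ.
  rewrite (gtr0_norm (al_gt0 n)) lerD2l -[X in _ * X](gtr0_norm Nx0) -normrM.
  by rewrite mulrBl mul1r divfK ?gt_eqF.
have d1 : `|al n - N x| <= e n * N x.
  by rewrite ler_distl; apply/andP; split; lra.
have d2 : e n * N x < 4^-1.
  by move: enx; rewrite invfM ltr_pdivlMr.
have d3 : N (u n - x') * N x < 4^-1.
  by move: dn; rewrite invfM ltr_pdivlMr.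
have al2 : al n <= 2 * N x.
  by rewrite (le_trans up)// ler_wpM2r ?(ltW Nx0)//; lra.
have d4 := ler_wpM2r (N_ge0 (u n - x')) al2.
by lra.
Unshelve. all: by end_near. Qed.

End Renorming.

(** * Choice of the functionals, of [p] and of the vectors [z n] *)

Theorem theorem1 (R : realType) (X : completeNormedModType R)
    (hinf : ~ finite_dimensional X) (hsep : separable_dual X) :
  exists N : X -> R,
    [/\ equivalent_norm N,
        weakly_locally_uniformly_rotund N
      & ~ locally_uniformly_rotund N].
Proof.
(* At [n = 0] the kernel condition is vacuous; this only extracts a unit vector. *)
have [x [x1 _]] := unit_vector_joint_kernel (fun=> \0 : {linear X -> R^o}) 0 hinf.
have [g [gle gx]] := norming_functional x.
have [h [hdual hdense]] := separable_dual_sequence hsep.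
pose h' k := if k is k'.+1 then h k' else g.
have /choice[M hM] k : exists M : R, 0 < M /\ forall y, `|h' k y| <= M * `|y|.
  case: k => [|k]; first by exists 1; split=> // y; rewrite mul1r.
  by have /topological_dualP[M M0 kM] := hdual k; exists M.
(* The bound [n.+1] puts index 0, that is [g], among the functionals killing [z n] even for
   [n = 0]. *)
have [z zP] := choice (fun n => unit_vector_joint_kernel h' n.+1 hinf).
(* On [a *: x + b *: z n] with [|b| <= |a|] the maximum is attained by the first
   term and equals [2 * |a|]: this is the flat part of the unit sphere of [p]. *)
pose p y := Num.max (2 * `|g y|) `|y|.
have M0 k : 0 < M k := (hM k).1.
have hle k y : `|h' k y| <= M k * `|y| := (hM k).2 y.
have pD y w : p (y + w) <= p y + p w.
  rewrite /p linearD ge_max; apply/andP; split.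
    apply: (@le_trans _ _ (2 * `|g y| + 2 * `|g w|)).
      by rewrite -mulrDr ler_wpM2l// ler_normD.
    by rewrite lerD// le_max lexx.
  by rewrite (le_trans (ler_normD _ _))// lerD// le_max lexx orbT.
have pZ a y : p (a *: y) = `|a| * p y.
  by rewrite /p linearZ/= !normrZ maxr_pMr// mulrCA.
have p_ge y : `|y| <= p y by rewrite le_max lexx orbT.
have p_le y : p y <= 2 * `|y|.
  by rewrite ge_max ler_wpM2l//= mulr2n mulrDl mul1r lerDl.
have h'dense f : topological_dual f -> forall e : R, 0 < e ->
    exists k, forall y, `|f y - h' k y| <= e * `|y|.
  by move=> fdual e e0; have [k fk] := hdense f fdual e e0; exists k.+1.
exists (quadratic_renorm h' M p); split.
- exact: (quadratic_renorm_equivalent M0 hle pD pZ p_ge p_le).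
- exact: (quadratic_renorm_wlur M0 hle pD p_ge h'dense).
- apply: (quadratic_renorm_not_lur M0 hle pD pZ p_ge (x := x) (z := z)).
  + by rewrite -normr_eq0 x1 oner_eq0.
  + by move=> n; case: (zP n).
  + by move=> n k kn; case: (zP n) => _; apply; exact: ltnW.
  + move=> n a b ba; have [zn1 zn] := zP n.
    have gz : g (z n) = 0 by exact: (zn 0).
    rewrite /p linearD !linearZ/= gz scaler0 addr0 gx x1 normr1 mulr1.
    rewrite [Num.max 2 1]max_l ?ler1n// [`|a *: _|]normrZ normr1 mulr1 mulrC max_l//.
    (* Here [|b| <= |a|] enters: [|a *: x + b *: z n| <= |a| + |b| <= 2 |a|]. *)
    rewrite (le_trans (ler_normD _ _))// !normrZ x1 zn1 !mulr1 mulr2n mulrDr mulr1.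
    by rewrite lerD2l.
Qed.
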